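(* Let $\mathcal{L}$ be a finite semidistributive lattice. Then $\mathcal{L}$ is atomic if and only if $\mathcal{L}\cong\mathrm{Bool}(n)$ for some $n\in\mathbb{N}$.
   Context: A finite lattice is join-semidistributive if for all $x,y,z$ with $x\vee y=x\vee z$ one has $x\vee(y\wedge z)=x\vee y$; meet-semidistributive is the dual condition; semidistributive means both. A lattice is atomic if every element is a join of atoms (elements covering $\hat0$). $\mathrm{Bool}(n)=(\wp(\{1,\dots,n\}),\subseteq)$ is the Boolean lattice. *)

(* Defs.v *)
From HB Require Import structures.
From mathcomp Require Import all_boot all_order.

Set Implicit Arguments.
Unset Strict Implicit.
Unset Printing Implicit Defensive.

Import Order.Theory Order.SetSubsetOrder.Exports.
Local Open Scope order_scope.

Definition join_semidistributive (d : Order.disp_t) (L : latticeType d) : Prop :=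
  forall x y z : L, x `|` y = x `|` z -> x `|` (y `&` z) = x `|` y.

Definition meet_semidistributive (d : Order.disp_t) (L : latticeType d) : Prop :=
  forall x y z : L, x `&` y = x `&` z -> x `&` (y `|` z) = x `&` y.

Definition semidistributive (d : Order.disp_t) (L : latticeType d) : Prop :=
  join_semidistributive L /\ meet_semidistributive L.

Definition covers (d : Order.disp_t) (P : porderType d) (y x : P) : Prop :=
  x < y /\ ~ (exists z : P, x < z /\ z < y).

Definition atom (d : Order.disp_t) (P : bPOrderType d) (a : P) : Prop :=
  covers a \bot.

(* The empty join is allowed, so that \bot is a join of atoms. *)
Definition atomic (d : Order.disp_t) (L : finTBLatticeType d) : Prop :=
  forall x : L, exists A : {set L},
    (forall a : L, a \in A -> atom a) /\ x = \join_(a in A) a.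

(* The ground set {1, ..., n} is represented by 'I_n = {0, ..., n - 1};
   SetSubsetOrder.type _ T is {set T} ordered by inclusion. *)
Definition Bool (n : nat) :
    ctbDistrLatticeType Order.SetSubsetOrder.subset_display :=
  Order.SetSubsetOrder.type Order.SetSubsetOrder.subset_display 'I_n.

Definition order_isomorphic (d d' : Order.disp_t)
    (P : porderType d) (Q : porderType d') : Prop :=
  exists f : P -> Q, bijective f /\ {mono f : x y / x <= y}.

(* Main.v *)
Require Import Defs.
From mathcomp Require Import all_boot all_order.

(** Meet-semidistributivity makes every atom [a] join-prime: if [a] lies below
    neither [y] nor [z], then [a `&` y = a `&` z = \bot], hence
    [a `&` (y `|` z) = \bot].  So an atom below a join of atoms is one of them,
    and when every element is a join of atoms, sending [x] to the set of atoms
    below [x] is an isomorphism onto the power set of the atoms.  Conversely,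
    the singletons of a power set are atoms and join to every subset. *)

Set Implicit Arguments.
Unset Strict Implicit.
Unset Printing Implicit Defensive.

Import Order.Theory Order.SetSubsetOrder.Exports.
Local Open Scope order_scope.

Lemma le_BoolE (n : nat) (A B : Bool n) :
  (A <= B) = ((A : {set 'I_n}) \subset (B : {set 'I_n})).
Proof. by []. Qed.

(** A boolean form of [atom], so that the atoms can be collected in a finite set by
    comprehension. *)
Definition atomb (d : Order.disp_t) (L : finTBLatticeType d) (a : L) : bool :=
  (a != \bot) && [forall z : L, (z < a) ==> (z == \bot)].

Lemma atomP (d : Order.disp_t) (L : finTBLatticeType d) (a : L) :
  reflect (atom a) (atomb a).
Proof.
apply: (iffP andP) => [[a0 /forallP h]|[a0 h]].
  split; first by rewrite lt0x.
  case=> z [z0 za]; move: (implyP (h z) za) => /eqP zE.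
  by rewrite zE ltxx in z0.
split; first by rewrite -lt0x.
apply/forallP => z; apply/implyP => za; apply/negPn/negP => z0.
by case: h; exists z; split=> //; rewrite lt0x.
Qed.

(** The meet lies below the atom [a], so it is [\bot] or [a], and it is [a] exactly when
    [a <= y]. *)
Lemma meet_atom_eq0 (d : Order.disp_t) (L : finTBLatticeType d) (a y : L) :
  atom a -> (a `&` y == \bot) = ~~ (a <= y).
Proof.
move=> /atomP /andP[a0 /forallP h].
have [ay|nay] := boolP (a <= y); first by rewrite (meet_idPl ay); apply: negbTE.
by apply: (implyP (h _)); rewrite lt_neqAle leIl andbT eq_meetl.
Qed.

Lemma atom_join_prime (d : Order.disp_t) (L : finTBLatticeType d) (a y z : L) :
  meet_semidistributive L -> atom a ->
  (a <= y `|` z) = (a <= y) || (a <= z).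
Proof.
move=> msd ata; apply: negb_inj; rewrite negb_or -!meet_atom_eq0 //.
apply/eqP/andP => [h|[/eqP hy /eqP hz]]; last by rewrite msd ?hy ?hz.
by split; rewrite -lex0 -h leI2 ?leUl ?leUr.
Qed.

Lemma atom_le_joins (d : Order.disp_t) (L : finTBLatticeType d)
    (I : finType) (B : {set I}) (F : I -> L) (a : L) :
  meet_semidistributive L -> atom a ->
  a <= \join_(i in B) F i -> exists2 i, i \in B & a <= F i.
Proof.
move=> msd ata.
apply: (big_ind (fun x => a <= x -> exists2 i, i \in B & a <= F i)).
(* The empty join is [\bot], which no atom lies below. *)
- by rewrite lex0; case/atomP/andP: ata => /negP.
- by move=> y z hy hz; rewrite atom_join_prime // => /orP[/hy|/hz].
- by move=> i iB ai; exists i.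
Qed.

Lemma atoms_antichain (d : Order.disp_t) (L : finTBLatticeType d) (a b : L) :
  atom a -> atom b -> a <= b -> a = b.
Proof.
move=> /atomP /andP[a0 _] /atomP /andP[_ /forallP h].
rewrite le_eqVlt => /orP[/eqP //|ab].
by rewrite (implyP (h a) ab) in a0.
Qed.

Lemma atomic_meet_semidistributive_Bool (d : Order.disp_t)
    (L : finTBLatticeType d) :
  meet_semidistributive L -> atomic L ->
  exists n : nat, order_isomorphic L (Bool n).
Proof.
move=> msd atL; pose At := [set a : L | atomb a].
have atE (i : 'I_#|At|) : atom (enum_val i).
  by apply/atomP; have := enum_valP i; rewrite inE.
pose f (x : L) : Bool #|At| := [set i : 'I_#|At| | enum_val i <= x].
pose g (B : Bool #|At|) : L := \join_(i in (B : {set 'I_#|At|})) enum_val i.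
have fK : cancel f g.
  move=> x; apply/le_anti/andP; split.
    by apply/joinsP => i; rewrite inE.
  (* Atomicity enters here: [x] is the join of some set [A] of atoms, and each of them, lying below
     [x], is among those that [g (f x)] joins. *)
  have [A [hA ->]] := atL x; apply/joinsP => a aA.
  have aAt : a \in At by rewrite inE; apply/atomP/hA.
  rewrite -(enum_rankK_in aAt aAt); apply: joins_sup.
  by rewrite inE enum_rankK_in //; apply: joins_sup aA.
have gK : cancel g f.
  move=> B; apply/setP => i; rewrite inE; apply/idP/idP => [|iB].
    (* Join-primeness puts the atom indexed by [i] below one indexed by some [j] in [B]; two
       comparable atoms coincide, so [i = j]. *)
    case/(atom_le_joins msd (atE i)) => j jB /(atoms_antichain (atE _) (atE _)).
    by move=> /enum_val_inj ->.
  by apply: joins_sup iB.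
exists #|At|, f; split; first by exists g.
move=> x y; rewrite le_BoolE; apply/subsetP/idP => [h|xy i]; last first.
  by rewrite !inE => /le_trans; apply.
rewrite -(fK x); apply/joinsP => i /h.
by rewrite inE.
Qed.

Lemma atomic_of_Bool (d : Order.disp_t) (L : finTBLatticeType d) (n : nat) :
  order_isomorphic L (Bool n) -> atomic L.
Proof.
case=> f [[g fK gK] fm].
(* The elements [g [set i]] will be the atoms; this tells which of them lie below [x]. *)
have gle (i : 'I_n) (x : L) :
    (g [set i] <= x) = (i \in (f x : {set 'I_n})).
  by rewrite -fm gK le_BoolE sub1set.
have f0 : f \bot = set0 :> {set 'I_n}.
  apply/eqP; rewrite -subset0 -le_BoolE -[X in _ <= X](gK set0).
  by rewrite fm le0x.
move=> x; exists [set g [set i] | i in (f x : {set 'I_n})]; split.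
  move=> _ /imsetP[i _ ->]; apply/atomP/andP; split.
    by rewrite -lex0 gle f0 inE.
  apply/forallP => z; apply/implyP => zi; rewrite -lex0 -fm f0.
  (* Since [f z] is a subset of [[set i]], it is [[set i]], which contradicts [z < g [set i]], or
     empty, which gives [z = \bot]. *)
  have := ltW zi; rewrite -fm gK le_BoolE subset1.
  case/orP=> /eqP fz; first by rewrite -fz fK ltxx in zi.
  by rewrite fz le_BoolE subxx.
apply/le_anti/andP; split; last first.
  by apply/joinsP => _ /imsetP[i ix ->]; rewrite gle.
rewrite -fm le_BoolE; apply/subsetP => i ix; rewrite -gle.
by apply: joins_sup; apply: imset_f.
Qed.

Theorem theorem2p10 (d : Order.disp_t) (L : finTBLatticeType d)
    (hL : semidistributive L) :
  atomic L <-> exists n : nat, order_isomorphic L (Bool n).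
Proof.
split; first exact: (atomic_meet_semidistributive_Bool hL.2).
by case=> n; apply: atomic_of_Bool.
Qed.
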